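(* Let $\Phi_{KZ}(X_0,X_1)$ be the Drinfel'd associator and $X_\infty=-X_0-X_1$. The relation $$e^{i\pi X_0}\Phi_{KZ}(X_\infty,X_0)e^{i\pi X_\infty}\Phi_{KZ}(X_1,X_\infty)e^{i\pi X_1}\Phi_{KZ}(X_0,X_1)=1$$ is equivalent to the family of relations: for all $W\in\{X_0,X_1\}^*\setminus\{\emptyset\}$, $$\sum_{\substack{W_1,\ldots,W_6\in\{X_0,X_1\}^*\\ W_1\cdots W_6=W}}\frac{(i\pi)^{|W_1|}}{|W_1|!}\tilde\alpha_0(W_1)\Bigg(\sum_{(\mathbf U,\mathbf k)\in\mathrm{dec}(W_2,X_0)}(-1)^{|W_2|}\zeta^{sh}(X_0^{|U_1|}X_1^{k_1}\cdots X_0^{|U_p|}X_1^{k_p})\Bigg)(-1)^{|W_3|}\frac{(i\pi)^{|W_3|}}{|W_3|!}$$ $$\times\Bigg(\sum_{(\mathbf V,\mathbf l)\in\mathrm{dec}(W_4,X_1)}\zeta^{sh}(X_1^{|V_1|}X_0^{l_1}\cdots X_1^{|V_p|}X_0^{l_p})\Bigg)\frac{(i\pi)^{|W_5|}}{|W_5|!}\tilde\alpha_1(W_5)\,(-1)^{\mathrm{dp}(W_6)}\zeta^{sh}(W_6)=0 .$$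
   Context: $\{X_0,X_1\}^*$ is the set of words in $X_0,X_1$ (with empty word $\emptyset=1$); $|W|$ is the length of $W$, $\mathrm{dp}(W)$ its number of letters $X_1$. The shuffle-regularized multiple zeta values $(\zeta^{sh}(W))_W$ are the real numbers determined by: $\zeta^{sh}(X_0)=\zeta^{sh}(X_1)=0$; $\zeta^{sh}(X_0^{k_1-1}X_1\cdots X_0^{k_p-1}X_1)=\sum_{n_1>\cdots>n_p>0}n_1^{-k_1}\cdots n_p^{-k_p}$ if $k_1\ge2$; $\zeta^{sh}(V)\zeta^{sh}(W)=\sum_U\zeta^{sh}(U)$ over all shuffles $U$ of $V,W$ (with multiplicity); $\zeta^{sh}(\emptyset)=1$. The Drinfel'd associator in $\mathbb C\langle\langle X_0,X_1\rangle\rangle$ is $\Phi_{KZ}(X_0,X_1)=\sum_W(-1)^{\mathrm{dp}(W)}\zeta^{sh}(W)W$; $\Phi_{KZ}(A,B)$ denotes the substitution $X_0\mapsto A$, $X_1\mapsto B$. For $i\in\{0,1\}$, $\alpha_i$ is the endomorphism of $\mathbb C\langle\langle X_0,X_1\rangle\rangle$ with $\alpha_i(X_i)=X_i$, $\alpha_i(X_{1-i})=0$, and $\tilde\alpha_i$ is the composition of $\alpha_i$ with $X_0,X_1\mapsto1$; so for a word $W$, $\tilde\alpha_i(W)=1$ if $W=X_i^n$ ($n\ge0$) and $0$ otherwise. For a word $W$ and $i\in\{0,1\}$, $\mathrm{dec}(W,X_i)$ is the set of tuples $(V_1,X_i^{k_1},\ldots,V_p,X_i^{k_p})$ (also written $(\mathbf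 V,\mathbf k)$) with $1\le p<\infty$, $V_j\in\{X_0,X_1\}^*$, $V_2,\ldots,V_p\neq\emptyset$, $k_1,\ldots,k_{p-1}>0$, $k_p\ge0$, and $W=V_1X_i^{k_1}\cdots V_pX_i^{k_p}$. *)

(* Defs.v *)
From HB Require Import structures.
From mathcomp Require Import all_boot all_order all_algebra.
From mathcomp Require Import all_classical all_reals all_analysis.
From mathcomp Require Export complex.

Set Implicit Arguments.
Unset Strict Implicit.
Unset Printing Implicit Defensive.

Import Order.TTheory GRing.Theory Num.Theory.
Local Open Scope classical_set_scope.
Local Open Scope ring_scope.

(* The letter X_i is the boolean i. *)
Definition letter : Type := bool.
HB.instance Definition _ := Countable.on letter.
Definition X0 : letter := false.
Definition X1 : letter := true.
Notation word := (seq letter).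

Definition dp (w : word) : nat := count_mem X1 w.

(* The list of all shuffles of two words, with multiplicity. *)
Fixpoint shuffle (v : word) : word -> seq word :=
  if v isn't a :: v' then fun w => [:: w] else
  fix shuffle_v (w : word) : seq word :=
    if w isn't b :: w' then [:: v] else
    map (cons a) (shuffle v' w) ++ map (cons b) (shuffle_v w').

(* X_0^{k_1 - 1} X_1 ... X_0^{k_p - 1} X_1 *)
Definition index_word (k : seq nat) : word :=
  flatten [seq rcons (nseq kj.-1 X0) X1 | kj <- k].

(* The sum over n_1 > ... > n_p > 0, as an element of [0, +oo]. *)
Definition mzv (R : realType) (k : seq nat) : \bar R :=
  \esum_(n in [set n : (size k).-tuple nat |
                 sorted gtn n && all (fun m => (0 < m)%N) n])
    (\prod_(j < size k) (tnth n j)%:R ^- nth 0%N k j)%:E.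

(* The properties which determine the shuffle-regularized multiple zeta
   values. In the second one, [head 0 k] is k_1, so that k is nonempty. *)
Record is_zeta_sh (R : realType) (zeta : word -> R) : Prop := IsZetaSh {
  zeta_sh_letter : forall x : letter, zeta [:: x] = 0;
  zeta_sh_mzv : forall k : seq nat,
    all (fun kj => (1 <= kj)%N) k -> (2 <= head 0%N k)%N ->
    (zeta (index_word k))%:E = mzv R k;
  zeta_sh_shuffle : forall v w : word,
    zeta v * zeta w = \sum_(u <- shuffle v w) zeta u;
  zeta_sh_nil : zeta [::] = 1
}.

(* K<<X_0, X_1>>: a series is the function giving its coefficients. *)
Definition ncseries (K : Type) : Type := word -> K.

Section NCSeriesRing.
Variable K : nzRingType.
Implicit Types f g h : ncseries K.

HB.instance Definition _ := GRing.Zmodule.copy (ncseries K) (word -> K).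

Definition ncone : ncseries K := fun w => (w == [::])%:R.

(* The sum runs over the factorizations w = u v. *)
Definition ncmul f g : ncseries K :=
  fun w => \sum_(j < (size w).+1) f (take j w) * g (drop j w).

Definition ncscale (c : K) f : ncseries K := fun w => c * f w.

Let shift (x : letter) f : ncseries K := fun w => f (x :: w).

Lemma ncmul_nil f g : ncmul f g [::] = f [::] * g [::].
Proof. by rewrite /ncmul big_ord1. Qed.

Lemma ncmul_cons f g x w :
  ncmul f g (x :: w) = f [::] * g (x :: w) + ncmul (fun u => f (x :: u)) g w.
Proof. by rewrite /ncmul /= big_ord_recl take0 drop0. Qed.

Lemma ncaddE f g w : (f + g) w = f w + g w.
Proof. by []. Qed.

Fact ncmulDl : left_distributive ncmul +%R.
Proof.
move=> f g h; apply/funext => w; rewrite ncaddE /ncmul -big_split /=.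
by apply: eq_bigr => j _; rewrite ncaddE mulrDl.
Qed.

Fact ncmulDr : right_distributive ncmul +%R.
Proof.
move=> f g h; apply/funext => w; rewrite ncaddE /ncmul -big_split /=.
by apply: eq_bigr => j _; rewrite ncaddE mulrDr.
Qed.

Fact ncscale_mull c f g : ncscale c (ncmul f g) = ncmul (ncscale c f) g.
Proof.
apply/funext => w; rewrite /ncscale /ncmul mulr_sumr.
by apply: eq_bigr => j _; rewrite mulrA.
Qed.

Fact ncmulA : associative ncmul.
Proof.
move=> f g h; apply/funext => w; elim: w f g h => [|x w IHw] f g h.
  by rewrite !ncmul_nil mulrA.
rewrite 2!ncmul_cons IHw ncmul_cons ncmul_nil mulrDr mulrA -addrA.
congr (_ + _).
have -> : (fun u => ncmul f g (x :: u)) =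
    ncscale (f [::]) (shift x g) + ncmul (shift x f) g.
  by apply/funext => u; rewrite ncmul_cons.
by rewrite ncmulDl ncaddE -ncscale_mull.
Qed.

Fact ncmul1l : left_id ncone ncmul.
Proof.
move=> f; apply/funext => -[|x w]; first by rewrite ncmul_nil mul1r.
rewrite ncmul_cons mul1r /ncmul big1 ?addr0// => j _.
by rewrite /ncone mul0r.
Qed.

Fact ncmul1r : right_id ncone ncmul.
Proof.
move=> f; apply/funext => w; elim: w f => [|x w IHw] f.
  by rewrite ncmul_nil mulr1.
by rewrite ncmul_cons mulr0 add0r IHw.
Qed.

Fact ncone_neq0 : ncone != 0.
Proof.
by apply/eqP => /(congr1 (fun f : ncseries K => f [::])) /eqP; rewrite oner_eq0.
Qed.

HB.instance Definition _ := GRing.Zmodule_isNzRing.Build (ncseries K)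
  ncmulA ncmul1l ncmul1r ncmulDl ncmulDr ncone_neq0.

Fact ncscaleA a b f : ncscale a (ncscale b f) = ncscale (a * b) f.
Proof. by apply/funext => w; rewrite /ncscale mulrA. Qed.

Fact ncscale1 : left_id 1 ncscale.
Proof. by move=> f; apply/funext => w; rewrite /ncscale mul1r. Qed.

Fact ncscaleDr : right_distributive ncscale +%R.
Proof. by move=> c f g; apply/funext => w; rewrite /ncscale mulrDr. Qed.

Fact ncscaleDl f : {morph ncscale^~ f : a b / a + b}.
Proof. by move=> a b; apply/funext => w; rewrite /ncscale mulrDl. Qed.

HB.instance Definition _ := GRing.Zmodule_isLmodule.Build K (ncseries K)
  ncscaleA ncscale1 ncscaleDr ncscaleDl.

Lemma ncmulE f g w :
  (f * g) w = \sum_(j < (size w).+1) f (take j w) * g (drop j w).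
Proof. by []. Qed.

Lemma nconeE w : (1 : ncseries K) w = (w == [::])%:R.
Proof. by []. Qed.

Lemma ncscaleE c f w : (c *: f) w = c * f w.
Proof. by []. Qed.

Definition ncword (u : word) : ncseries K := fun w => (w == u)%:R.

Definition ncX (x : letter) : ncseries K := ncword [:: x].

(* The image of the word u under X_i |-> S i. *)
Definition word_subst (S : letter -> ncseries K) (u : word) : ncseries K :=
  \prod_(x <- u) S x.

(* The image of f under X_i |-> S i, where the S i have no constant term.
   By [word_subst_eq0] each coefficient is then a sum with finite support. *)
Definition ncsubst (S : letter -> ncseries K) f : ncseries K :=
  fun w => \sum_(u \in [set: word]) f u * word_subst S u w.

Lemma word_subst_eq0 (S : letter -> ncseries K) (u w : word) :
  (forall x, S x [::] = 0) -> (size w < size u)%N -> word_subst S u w = 0.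
Proof.
move=> S0; rewrite /word_subst; elim: u w => [//|x u IHu] w lt_w.
rewrite big_cons ncmulE big1// => -[[|j] ltj] _ /=.
  by rewrite take0 S0 mul0r.
rewrite IHu ?mulr0// size_drop; case: w lt_w ltj => [|y w] //=.
rewrite !ltnS => lt_w _.
by rewrite subSS (leq_ltn_trans (leq_subr _ _)).
Qed.

Lemma expr_series_eq0 f (n : nat) (w : word) :
  f [::] = 0 -> (size w < n)%N -> (f ^+ n) w = 0.
Proof.
move=> f0 ltwn; have -> : f ^+ n = word_subst (fun=> f) (nseq n X0).
  by rewrite /word_subst big_nseq; elim: n {ltwn} => //= n <-; rewrite exprS.
by apply: word_subst_eq0 => //; rewrite size_nseq.
Qed.

Lemma ncwordE u : ncword u = word_subst ncX u.
Proof.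
rewrite /word_subst; elim: u => [|x u IHu]; first by rewrite big_nil.
rewrite big_cons -IHu; apply/funext => -[|y w].
  by rewrite ncmulE big_ord1 mul0r.
rewrite ncmulE big_ord_recl take0 mul0r add0r big_ord_recl /= take0 drop0.
rewrite big1 ?addr0 => [|j _]; first by rewrite /ncX /ncword !eqseq_cons eqxx andbT -natrM mulnb.
case: w j => [|z w] [j ltj] //=.
by rewrite /ncX /ncword eqseq_cons andbF mul0r.
Qed.

Lemma ncsubst_id f : ncsubst ncX f = f.
Proof.
apply/funext => w; rewrite /ncsubst.
under eq_fsbigr do rewrite -ncwordE.
rewrite -(fsbig_widen [set w])//=.
  by rewrite fsbig_set1 /ncword eqxx mulr1.
by move=> u [_ /= uw]; rewrite /ncword; case: eqP => [wu|]; rewrite ?mulr0//; case: uw.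
Qed.

End NCSeriesRing.

Arguments ncX {K} x.
Arguments ncword {K} u.

(* The exponential of f, where f has no constant term. By [expr_series_eq0]
   each coefficient is then a sum with finite support. *)
Definition ncexp (K : fieldType) (f : ncseries K) : ncseries K :=
  fun w => \sum_(n \in [set: nat]) n`!%:R^-1 * (f ^+ n) w.

Definition alpha (K : nzRingType) (i : letter) : ncseries K -> ncseries K :=
  ncsubst (fun x => if x == i then ncX x else 0).

(* The composition of alpha_i with X_0, X_1 |-> 1, on words: the second map
   sends a polynomial to the sum of its coefficients. *)
Definition tilde_alpha (K : nzRingType) (i : letter) (w : word) : K :=
  \sum_(u \in [set: word]) @alpha K i (ncword w) u.

Lemma tilde_alphaE (K : nzRingType) (i : letter) (w : word) :
  tilde_alpha K i w = (w == nseq (size w) i)%:R.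
Proof.
pose S x : ncseries K := if x == i then ncX x else 0.
rewrite /tilde_alpha.
have -> : alpha i (ncword w) = word_subst S w :> ncseries K.
  apply/funext => v; rewrite /alpha /ncsubst -(fsbig_widen [set w])//=.
    by rewrite fsbig_set1 /ncword eqxx mul1r.
  by move=> u [_ /= uw]; rewrite /ncword; case: eqP => [//|_]; rewrite mul0r.
case: eqP => [->|nw].
  have -> : word_subst S (nseq (size w) i) = ncword (nseq (size w) i) :> ncseries K.
    rewrite ncwordE /word_subst !big_nseq; congr iter.
    by apply/funext => g; rewrite /S eqxx.
  rewrite -(fsbig_widen [set nseq (size w) i])//=.
    by rewrite fsbig_set1 /ncword eqxx.
  by move=> u [_ /= uw]; rewrite /ncword; case: eqP.
have -> : word_subst S w = 0; last by rewrite fsbig1.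
rewrite /word_subst; elim: w nw => [//|x w IHw] nw; rewrite big_cons.
case: (eqVneq x i) => [xi|xi]; last by rewrite /S (negbTE xi) mul0r.
by rewrite IHw ?mulr0// => nw'; apply: nw; rewrite /= -nw' xi.
Qed.

Section Associator.
Variables (R : realType) (zeta : word -> R).

Definition Phi_KZ : ncseries R[i] :=
  fun w => (-1) ^+ dp w * (zeta w)%:C%C.

Definition Phi_KZ_at (A B : ncseries R[i]) : ncseries R[i] :=
  ncsubst (fun x => if x == X0 then A else B) Phi_KZ.

Definition ipi : R[i] := ('i * pi%:C)%C.

Definition ipi_coef (w : word) : R[i] := ipi ^+ size w / (size w)`!%:R.

End Associator.

Arguments ipi R : clear implicits.
Arguments ipi_coef R w : clear implicits.

Definition Xoo (R : realType) : ncseries R[i] := - ncX X0 - ncX X1.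
Arguments Xoo R : clear implicits.

(* dec(w, X_i): (V_1, X_i^{k_1}, ..., V_p, X_i^{k_p}) is encoded as
   [:: (V_1, k_1); ...; (V_p, k_p)]. *)
Definition dec (w : word) (i : letter) : set (seq (word * nat)) :=
  [set d | [/\ (0 < size d)%N,
               all (fun e => e.1 != [::]) (behead d),
               all (fun e => (0 < e.2)%N) (take (size d).-1 d) &
               w = flatten [seq e.1 ++ nseq e.2 i | e <- d]]].

(* X_a^{|V_1|} X_b^{k_1} ... X_a^{|V_p|} X_b^{k_p} *)
Definition dec_word (a b : letter) (d : seq (word * nat)) : word :=
  flatten [seq nseq (size e.1) a ++ nseq e.2 b | e <- d].

Definition factor6 (w : word) :
    set (word * word * word * word * word * word) :=
  [set W | let: (W1, W2, W3, W4, W5, W6) := W in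
           W1 ++ W2 ++ W3 ++ W4 ++ W5 ++ W6 = w].

(* Main.v *)
Require Import Defs.
From mathcomp Require Import all_boot all_order all_algebra.
From mathcomp Require Import all_classical all_reals all_analysis.
Local Open Scope classical_set_scope.
Local Open Scope ring_scope.

Import GRing.Theory.

(** A series is its family of coefficients, so the relation says that the
    product on its left has constant term 1 and all other coefficients 0. The
    constant term is always 1, as every factor has constant term 1; what
    has to be seen is that the sum indexed by [W] is the coefficient of [W].

    The coefficient of [W] in a product of six series is a sum over the
    factorizations of [W] into six words ([ncmul6_factorizations]), so it is
    enough to compute each factor. All the substituted series are linear forms
    in [X0] and [X1]. A product of [n] linear forms has coefficients only at
    words of length [n], where they are products of coefficients of the forms;
    this gives the exponentials ([ncexp_linear]), and shows that the coefficient
    of [w] in a linear substitution of [f] is a sum of [f u] over words [u] of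
    the length of [w], with weights which are computed letter by letter
    ([ncsubst_linear]).

    In both inner associators one letter, X_i, is replaced by X_oo, which takes
    any letter of [w] with the sign -1, and the other letter is replaced by
    X_i, which takes only the letters X_i of [w]. The words [u] which contribute
    are thus obtained by choosing letters X_i of [w], marking these with the
    other letter and replacing all the remaining letters of [w] by X_i. Such
    a choice cuts [w] into maximal unmarked and marked blocks, and these
    cuttings are exactly the elements of [dec w i] ([dec_bij]). The signs come
    out because (-1)^dp(u) is multiplied by -1 for each letter X_i of [u]. *)

(** * Products and substitutions of linear forms *)

Section LinearSeries.
Context {K : comNzRingType}.
Implicit Types (c : letter -> K) (f : ncseries K) (w : word).

Definition linear_series c : ncseries K :=
  fun w => if w is [:: y] then c y else 0.

Lemma ncX_linear (x : letter) :
  ncX x = linear_series (fun y => (y == x)%:R) :> ncseries K.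
Proof.
apply/funext => -[|y [|z w]] //; rewrite /ncX /ncword /= eqseq_cons ?andbT //.
by rewrite andbF.
Qed.

Lemma linear_series_mul c f y w :
  (linear_series c * f) (y :: w) = c y * f w.
Proof.
rewrite ncmulE big_ord_recl take0 mul0r add0r big_ord_recl /= take0 drop0.
rewrite big1 ?addr0 // => -[j ltj] _ /=.
by case: w ltj => [|z w] //= _; rewrite mul0r.
Qed.

(** Both sides peel off one letter at a time: a linear form as the left factor
    consumes exactly the first letter of [w]. *)
Lemma word_subst_linear (c : letter -> letter -> K) (u w : word) :
  word_subst (fun x => linear_series (c x)) u w =
  (size u == size w)%:R * \prod_(p <- zip u w) c p.1 p.2.
Proof.
rewrite /word_subst; elim: u w => [|x u IHu] w.
  by rewrite big_nil nconeE; case: w => [|y w]; rewrite big_nil mulr1.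
rewrite big_cons; case: w => [|y w].
  by rewrite ncmulE big_ord1 !mul0r.
by rewrite linear_series_mul IHu big_cons eqSS mulrCA.
Qed.

Lemma ncsubst_linear (c : letter -> letter -> K) f w :
  ncsubst (fun x => linear_series (c x)) f w =
  \sum_(u \in [set u : word | size u = size w])
    f u * \prod_(p <- zip u w) c p.1 p.2.
Proof.
rewrite /ncsubst -(fsbig_widen [set u : word | size u = size w]) //=.
  apply: eq_fsbigr => u; rewrite inE /= => eq_uw.
  by rewrite word_subst_linear eq_uw eqxx mul1r.
move=> u [_ /= /eqP/negbTE ne_uw].
by rewrite word_subst_linear ne_uw mul0r mulr0.
Qed.

Lemma ncsubst_nil (S : letter -> ncseries K) f :
  (forall x, S x [::] = 0) -> ncsubst S f [::] = f [::].
Proof.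
move=> S0; rewrite /ncsubst -(fsbig_widen [set [::] : word]) //=.
  by rewrite fsbig_set1 /word_subst big_nil mulr1.
move=> [|x u] [_ /= ne_u]; first by case: ne_u.
by rewrite word_subst_eq0 // mulr0.
Qed.

Lemma linear_series_exp c n w :
  (linear_series c ^+ n) w = (n == size w)%:R * \prod_(y <- w) c y.
Proof.
elim: n w => [|n IHn] [|y w]; rewrite ?expr0 ?nconeE ?big_nil ?mulr1 ?mul0r //.
  by rewrite exprS ncmulE big_ord1 mul0r.
by rewrite exprS linear_series_mul IHn big_cons eqSS mulrCA.
Qed.

End LinearSeries.

Section Exponential.
Context {K : fieldType}.

(** Only the [size w]-th power of a linear form contributes to the
    coefficient of [w]. *)
Lemma ncexp_linear (c : letter -> K) w :
  ncexp (linear_series c) w = (size w)`!%:R^-1 * \prod_(y <- w) c y.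
Proof.
rewrite /ncexp -(fsbig_widen [set size w]) //=.
  by rewrite fsbig_set1 linear_series_exp eqxx mul1r.
by move=> n [_ /= /eqP/negbTE nw]; rewrite linear_series_exp nw mul0r mulr0.
Qed.

Lemma ncexp_scale_ncX (a : K) (i : letter) w :
  ncexp (a *: ncX i) w = a ^+ size w / (size w)`!%:R * (w == nseq (size w) i)%:R.
Proof.
have -> : a *: ncX i = linear_series (fun y => a * (y == i)%:R) :> ncseries K.
  rewrite ncX_linear; apply/funext => -[|y [|z u]]; rewrite ncscaleE //= mulr0 //.
rewrite ncexp_linear mulrC -mulrA [_^-1 * _]mulrC mulrA; congr (_ / _).
elim: w => [|y w IHw] /=; first by rewrite big_nil expr0 mul1r.
by rewrite big_cons IHw eqseq_cons exprS mulrACA -natrM mulnb.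
Qed.

End Exponential.

(** * Decompositions of a word and choices of letters *)

Section Decompositions.
Implicit Types (u w : word) (d : seq (word * nat)).

Definition expand (i : letter) d : word :=
  flatten [seq e.1 ++ nseq e.2 i | e <- d].

(** The conditions in [dec] which make the blocks maximal: without them the
    same choice of letters could be cut in several ways. *)
Definition separated d : bool :=
  all (fun e => e.1 != [::]) (behead d) &&
  all (fun e => (0 < e.2)%N) (take (size d).-1 d).

(** The words [u] of the length of [w] for which this holds are those with a
    nonzero weight when X_i is replaced by X_oo and the other letter by X_i. *)
Definition masks (i : letter) u w : bool :=
  all (fun p => (p.1 != i) ==> (p.2 == i)) (zip u w).

(** Reads the decomposition off the marks, from right to left. The head of
    the result is a block to which the next letter may still be added:
    an unmarked letter always joins it, while a marked letter joins it only if
    its unmarked part is still empty, and otherwise opens a new block. The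
    starting value is the trivial decomposition of the empty word, so that
    the last block alone can end with zero marked letters. *)
Fixpoint blocks (i : letter) u w : seq (word * nat) :=
  match u, w with
  | x :: u', y :: w' =>
    let d := blocks i u' w' in
    let e := head ([::], 0%N) d in
    if x == i then (y :: e.1, e.2) :: behead d
    else if e.1 == [::] then ([::], e.2.+1) :: behead d
    else ([::], 1%N) :: d
  | _, _ => [:: ([::], 0%N)]
  end.

Lemma blocks_cons i u w :
  blocks i u w = head ([::], 0%N) (blocks i u w) :: behead (blocks i u w).
Proof.
case: u => [|x u]; case: w => [|y w] //=.
by case: ifP => _ //; case: ifP.
Qed.

Lemma blocksP i u w : size u = size w -> masks i u w ->
  [/\ separated (blocks i u w), expand i (blocks i u w) = w &
      dec_word i (~~ i) (blocks i u w) = u].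
Proof.
elim: u w => [|x u IHu] [|y w] //= [/IHu{}IHu].
rewrite /masks /= => /andP[xy /IHu].
rewrite (blocks_cons i u w); case: (head _ _) (behead _) => V k d.
rewrite /separated /expand /dec_word /= => -[/andP[sepV sepk] <- <-].
case: eqP xy => [-> _|/eqP xi /= /eqP ->] /=.
  by split=> //; case: d sepV sepk => [|e d] //= -> ->.
have -> : x = ~~ i by apply/eqP; move: xi; case: (x); case: (i).
case: V sepV sepk => [|z V] /= sepV sepk; split=> //=.
  by case: d sepV sepk => [|e d] //= -> /andP[_ ->].
by rewrite sepV sepk.
Qed.

(** Uniqueness of the decomposition. Reading a block from its right end, its
    marked letters cannot join the next block, whose unmarked part is nonempty,
    so the first of them opens a new block, which the remaining letters join. *)
Lemma blocks_dec_word i d : d != [::] -> separated d ->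
  blocks i (dec_word i (~~ i) d) (expand i d) = d.
Proof.
elim: d => [//|[V k] d IHd] _ sep.
rewrite /dec_word /expand /= -!catA.
have cutV u w : blocks i (nseq (size V) i ++ u) (V ++ w) =
    let d' := blocks i u w in
    (V ++ (head ([::], 0%N) d').1, (head ([::], 0%N) d').2) :: behead d'.
  elim: V {sep} => [|y V IHV] /=; last by rewrite eqxx IHV.
  by rewrite -surjective_pairing -blocks_cons.
rewrite cutV; case: d IHd sep => [_ _|[V' k'] d IHd] /=.
  rewrite !cats0.
  have -> : blocks i (nseq k (~~ i)) (nseq k i) = [:: ([::], k)].
    by elim: k => //= k ->; case: (i).
  by rewrite /= cats0.
rewrite /separated /= -andbA => /and4P[V'0 sepV k_gt0 sepk].
have {}IHd : blocks i (dec_word i (~~ i) ((V', k') :: d))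
                      (expand i ((V', k') :: d)) = (V', k') :: d.
  by apply: IHd => //; rewrite /separated /= sepV.
rewrite /dec_word /expand /= in IHd.
move: ((nseq (size V') i ++ _) ++ _) ((V' ++ _) ++ _) IHd => u' w' IHd.
case: k k_gt0 => // k _.
have bi : (~~ i == i) = false by case: (i).
(* Since [V'] is nonempty, [k.+1] marked letters form a block of their own. *)
have -> : blocks i (nseq k.+1 (~~ i) ++ u') (nseq k.+1 i ++ w') =
    ([::], k.+1) :: (V', k') :: d.
  elim: k => [|k IHk]; first by rewrite /= bi IHd /= (negbTE V'0).
  by rewrite /= bi; move: IHk => /=; rewrite bi => ->.
by rewrite /= cats0.
Qed.

(** The inverse map is [blocks i ^~ w]. *)
Lemma dec_bij (w : word) (i : letter) :
  set_bij (dec w i) [set u : word | size u = size w /\ masks i u w]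
    (dec_word i (~~ i)).
Proof.
have decE d : dec w i d <-> [/\ d != [::], separated d & w = expand i d].
  rewrite /dec /separated /=; split.
    by case=> d_gt0 -> -> ->; split=> //; case: d d_gt0.
  by case=> d0 /andP[sep1 sep2] ->; split=> //; case: d d0 {sep1 sep2}.
split.
- move=> d /decE [_ _ ->]; elim: d => [//|[V k] d [IHs IHm]] /=.
  rewrite /dec_word /expand /=; split.
    by rewrite !size_cat !size_nseq; congr (_ + _)%N; exact: IHs.
  have bi : (~~ i == i) = false by case: (i).
  rewrite /masks !zip_cat ?size_cat ?size_nseq // !all_cat.
  apply/andP; split; last exact: IHm.
  apply/andP; split.
    by elim: V => //= y V ->; rewrite eqxx.
  by elim: k => //= k ->; rewrite eqxx implybT.
- move=> d d'; rewrite !inE => /decE [d0 sep wE] /decE [d'0 sep' wE'] eq_dd'.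
  by rewrite -(blocks_dec_word i d d0 sep) -wE eq_dd' wE' blocks_dec_word.
- move=> u /= [szu mu]; have [sep wE uE] := blocksP i u w szu mu.
  by exists (blocks i u w) => //; apply/decE; split=> //; rewrite blocks_cons.
Qed.

End Decompositions.

(** * Substituting X_oo for one letter *)

Section Substitution.
Context {R : realType}.

Lemma Xoo_linear : Xoo R = linear_series (fun=> -1).
Proof.
have oppE (f : ncseries R[i]) w : (- f) w = - f w by [].
rewrite /Xoo !ncX_linear; apply/funext => -[|y [|z w]];
  rewrite ncaddE !oppE /= ?subr0 ?oppr0 //.
by case: y; rewrite ?oppr0 ?add0r ?addr0.
Qed.

(** This covers both inner associators: [Phi_KZ] at (X_oo, X_0) is the case
    [i = X0], and [Phi_KZ] at (X_1, X_oo) is the case [i = X1]. *)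
Lemma ncsubst_dec (f : ncseries R[i]) (i : letter) w :
  ncsubst (fun x => if x == i then Xoo R else ncX i) f w =
  \sum_(d \in dec w i)
    (-1) ^+ count_mem i (dec_word i (~~ i) d) * f (dec_word i (~~ i) d).
Proof.
(* [c x y] is the coefficient of the letter [y] in the image of [x]. *)
pose c x y : R[i] := if x == i then -1 else (y == i)%:R.
have -> : (fun x => if x == i then Xoo R else ncX i) =
    (fun x => linear_series (c x)).
  apply/funext => x; rewrite /c Xoo_linear ncX_linear.
  by case: ifP.
rewrite ncsubst_linear.
rewrite -(reindex_fsbig _ _ _ (fun u => (-1) ^+ count_mem i u * f u) (dec_bij w i)).
rewrite -(fsbig_widen [set u : word | size u = size w /\ masks i u w]
  [set u : word | size u = size w]) /=; last first.
- (* A position where [u] does not mask [w] contributes a factor 0. *)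
  move=> u [/= szu]; move=> /not_andP[//|/negP mu].
  apply/eqP; rewrite mulf_eq0; apply/orP; right.
  rewrite prodf_seq_eq0; case/allPn: mu => p pin; rewrite negb_imply => /andP[p1 p2].
  by apply/hasP; exists p => //; rewrite /c (negbTE p1) (negbTE p2) /=.
- by move=> u [].
apply: eq_fsbigr => u; rewrite inE /= => -[szu mu]; rewrite mulrC; congr (_ * _).
elim: u w szu mu => [|x u IHu] [|y w] //=; first by rewrite big_nil.
rewrite big_cons /masks /= => -[szu] /andP[xy mu].
rewrite IHu // exprD /c /=; congr (_ * _).
by case: eqP xy => //= _ /eqP ->; rewrite eqxx.
Qed.

End Substitution.

(** * Coefficients of a product *)

Section Factorizations.
Context {K : nzRingType}.

(** Stated for a series which is already a sum over some type [T] of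
    factorizations, [c t] being the word which [t] factors, so that it can be
    iterated: the conclusion has the form of the two hypotheses, for the type
    [T * word]. *)
Lemma ncmul_factorizations (T : choiceType) (c : T -> word) (phi : T -> K)
    (f g : ncseries K) :
  (forall w, finite_set [set t | c t = w]) ->
  (forall w, f w = \sum_(t \in [set t | c t = w]) phi t) ->
  (forall w, finite_set [set p : T * word | c p.1 ++ p.2 = w]) /\
  (forall w, (f * g) w =
     \sum_(p \in [set p : T * word | c p.1 ++ p.2 = w]) phi p.1 * g p.2).
Proof.
move=> fin fE.
have /choice[s sP] v : exists s : seq T, uniq s /\ [set t | c t = v] = [set` s].
  have /finite_seqP[s sE] := fin v.
  exists (undup s); rewrite undup_uniq sE; split=> //.
  by apply/seteqP; split=> t /=; rewrite mem_undup.
have s_uniq v : uniq (s v) := (sP v).1.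
have s_in v t : (t \in s v) = (c t == v).
  by apply/idP/eqP; rewrite -[c t = v]/([set t' | c t' = v] t) (sP v).2.
(* An enumeration of the factorizations in the order of the sum defining
   [(f * g) w]: first the place of the last cut, then the prefix. *)
pose e w := [seq (t, drop j w) | j <- iota 0 (size w).+1, t <- s (take j w)].
have e_in w p : (p \in e w) = (c p.1 ++ p.2 == w).
  apply/allpairsPdep/eqP => [[j [t [_ + ->]]]|<-].
    by rewrite s_in /= => /eqP ->; rewrite cat_take_drop.
  exists (size (c p.1)), p.1; rewrite mem_iota s_in drop_size_cat // take_size_cat //.
  by rewrite eqxx ltnS size_cat leq_addr; case: (p).
have e_uniq w : uniq (e w).
  have sz j t : j \in iota 0 (size w).+1 -> t \in s (take j w) -> size (c t) = j.
    by rewrite mem_iota ltnS s_in => /= j_le /eqP ->; exact: size_takel.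
  apply: allpairs_uniq_dep => [|j _|]; [exact: iota_uniq|exact: s_uniq|].
  move=> p q /allpairsPdep[j [t [jw tw ->]]] /allpairsPdep[j' [t' [jw' tw' ->]]].
  by case=> eq_t _; rewrite -(sz j t jw tw) -(sz j' t' jw' tw') eq_t.
have eE w : [set p : T * word | c p.1 ++ p.2 = w] = [set` e w].
  by apply/seteqP; split=> p /=; rewrite e_in => /eqP.
split=> w; first by rewrite eE; exact: finite_seq.
rewrite eE -fsbig_seq // /e -[iota _ _]/(index_iota 0 (size w).+1).
rewrite big_allpairs_dep big_mkord ncmulE.
by apply: eq_bigr => j _; rewrite fE (sP _).2 -fsbig_seq //= mulr_suml.
Qed.

Lemma ncmul6_factorizations (f1 f2 f3 f4 f5 f6 : ncseries K) (w : word) :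
  (f1 * f2 * f3 * f4 * f5 * f6) w =
  \sum_(F \in factor6 w)
    (let: (w1, w2, w3, w4, w5, w6) := F in
     f1 w1 * f2 w2 * f3 w3 * f4 w4 * f5 w5 * f6 w6).
Proof.
have fin1 (v : word) : finite_set [set t : word | t = v] := finite_set1 v.
have E1 v : f1 v = \sum_(t \in [set t : word | t = v]) f1 t.
  by rewrite fsbig_set1.
have [fin2 E2] := ncmul_factorizations _ _ _ _ f2 fin1 E1.
have [fin3 E3] := ncmul_factorizations _ _ _ _ f3 fin2 E2.
have [fin4 E4] := ncmul_factorizations _ _ _ _ f4 fin3 E3.
have [fin5 E5] := ncmul_factorizations _ _ _ _ f5 fin4 E4.
have [_ ->] := ncmul_factorizations _ _ _ _ f6 fin5 E5.
have -> : factor6 w = [set p | (((((p.1.1.1.1.1 ++ p.1.1.1.1.2) ++ p.1.1.1.2)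
    ++ p.1.1.2) ++ p.1.2) ++ p.2) = w].
  by apply/seteqP; split=> -[[[[[w1 w2] w3] w4] w5] w6]; rewrite /factor6 /= !catA.
by apply: eq_fsbigr => -[[[[[w1 w2] w3] w4] w5] w6] _.
Qed.

End Factorizations.

(** * The factors of the hexagon relation *)

Section Coefficients.
Context {R : realType} (zeta : word -> R).

Lemma size_dec_word w i d : dec w i d -> size (dec_word i (~~ i) d) = size w.
Proof. by case: (dec_bij w i) => + _ _ => /[apply] -[]. Qed.

(** Each letter [X1] of [u] gives a sign in [Phi_KZ] and each letter [X0] of [u]
    gives a sign in the substitution, hence one sign for each letter of [w]. *)
Lemma Phi_KZ_at_Xoo_X0 w :
  Phi_KZ_at zeta (Xoo R) (ncX X0) w =
  \sum_(d \in dec w X0) (-1) ^+ size w * (zeta (dec_word X0 X1 d))%:C%C.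
Proof.
rewrite /Phi_KZ_at ncsubst_dec; apply: eq_fsbigr => d; rewrite inE => /size_dec_word <-.
rewrite /Phi_KZ mulrA -exprD /dp; congr (_ ^+ _ * _).
rewrite -(count_predC (pred1 X0)); congr (_ + _)%N.
by apply: eq_count => -[].
Qed.

(** Here both signs count the letters [X1] of [u], and they cancel. *)
Lemma Phi_KZ_at_X1_Xoo w :
  Phi_KZ_at zeta (ncX X1) (Xoo R) w =
  \sum_(d \in dec w X1) (zeta (dec_word X1 X0 d))%:C%C.
Proof.
rewrite /Phi_KZ_at.
have -> : (fun x => if x == X0 then ncX X1 else Xoo R) =
    (fun x => if x == X1 then Xoo R else ncX X1).
  by apply/funext => -[].
rewrite ncsubst_dec; apply: eq_fsbigr => d _.
by rewrite /Phi_KZ /dp mulrA -exprD addnn -mul2n exprM sqrrN expr1n expr1n mul1r.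
Qed.

Lemma ncexp_ipi_ncX i w :
  ncexp (ipi R *: ncX i) w = ipi_coef R w * tilde_alpha R[i] i w.
Proof. by rewrite ncexp_scale_ncX tilde_alphaE. Qed.

Lemma ncexp_ipi_Xoo w :
  ncexp (ipi R *: Xoo R) w = (-1) ^+ size w * ipi_coef R w.
Proof.
have -> : ipi R *: Xoo R = linear_series (fun=> - ipi R).
  rewrite Xoo_linear; apply/funext => -[|y [|z u]];
    by rewrite ncscaleE /= ?mulr0 ?mulrN1.
rewrite ncexp_linear big_const_seq count_predT iter_mulr_1 (exprNn (ipi R)).
by rewrite /ipi_coef mulrC mulrA.
Qed.

End Coefficients.

Theorem corollary2p12 (R : realType) (zeta : word -> R)
    (hzeta : is_zeta_sh zeta) :
  ncexp (ipi R *: ncX X0) * Phi_KZ_at zeta (Xoo R) (ncX X0)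
  * ncexp (ipi R *: Xoo R) * Phi_KZ_at zeta (ncX X1) (Xoo R)
  * ncexp (ipi R *: ncX X1) * Phi_KZ_at zeta (ncX X0) (ncX X1) = 1
  <->
  forall W : word, W <> [::] ->
    \sum_(F \in factor6 W)
      (let: (W1, W2, W3, W4, W5, W6) := F in
       ipi_coef R W1 * tilde_alpha R[i] X0 W1
       * (\sum_(d \in dec W2 X0)
            (-1) ^+ size W2 * (zeta (dec_word X0 X1 d))%:C%C)
       * ((-1) ^+ size W3 * ipi_coef R W3)
       * (\sum_(d \in dec W4 X1) (zeta (dec_word X1 X0 d))%:C%C)
       * (ipi_coef R W5 * tilde_alpha R[i] X1 W5)
       * ((-1) ^+ dp W6 * (zeta W6)%:C%C)) = 0.
Proof.
set P := _ * Phi_KZ_at _ _ _.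
have P0 : P [::] = 1.
  have Xoo_0 : Xoo R [::] = 0 by rewrite Xoo_linear.
  have mul_nil (f g : ncseries R[i]) : (f * g) [::] = f [::] * g [::].
    exact: ncmul_nil.
  rewrite /P !mul_nil !ncexp_ipi_ncX ncexp_ipi_Xoo !tilde_alphaE /ipi_coef /=.
  rewrite /Phi_KZ_at !ncsubst_nil; try by move=> x; case: ifP.
  by rewrite /Phi_KZ /= (zeta_sh_nil hzeta) !expr0 fact0 invr1 !mulr1.
have P1E : P = 1 <-> forall W : word, W <> [::] -> P W = 0.
  split=> [-> W /eqP/negbTE W0|PW]; first by rewrite nconeE W0.
  by apply/funext => -[|x W]; [exact: P0 | rewrite PW].
have idE : (fun x => if x == X0 then ncX X0 else ncX X1) = @ncX R[i].
  by apply/funext => -[].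
apply: (iff_trans P1E); split=> PW W W0; apply: etrans (PW W W0);
  rewrite /P ncmul6_factorizations; apply: eq_fsbigr;
  move=> [[[[[W1 W2] W3] W4] W5] W6] _;
  rewrite !ncexp_ipi_ncX Phi_KZ_at_Xoo_X0 ncexp_ipi_Xoo Phi_KZ_at_X1_Xoo;
  by rewrite /Phi_KZ_at idE ncsubst_id.
Qed.
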